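(* Every $4$-connected $1$-plane graph has a connected spanning plane subgraph. That is, if $G$ is a $4$-connected graph together with a $1$-plane drawing of $G$, then there is a connected subgraph $F$ of $G$ with $V(F)=V(G)$ such that no two edges of $F$ cross each other in the given drawing of $G$.
   Context: All graphs are finite, simple and undirected. A (plane) drawing of a graph represents the vertices by distinct points of the plane and the edges by non-self-intersecting arcs joining the points of their end vertices and containing no vertex point in their interior. A $1$-plane graph is a graph given together with a plane drawing in which each edge is crossed at most once by another edge, i.e. each edge has at most one crossing point; crossings of adjacent edges are forbidden. A spanning plane subgraph of a $1$-plane graph $G$ is a subgraph $F$ with $V(F)=V(G)$ that is a plane graph with respect to the given drawing of $G$, i.e. no two edges of $F$ cross in that drawing. The connectivity is $\kappa(G)=\min\{p(u,v) : u,v\in V(G), u\neq v\}$, where $p(u,v)$ is the maximum number of pairwise internally vertex-disjoint $uv$-paths; $G$ is $k$-connected if $\kappa(G)\ge k$. *)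

(* Defs.v *)
From HB Require Import structures.
From mathcomp Require Import all_boot all_order all_algebra.
From mathcomp Require Import all_classical all_reals all_analysis.

Set Implicit Arguments.
Unset Strict Implicit.
Unset Printing Implicit Defensive.

Import Order.TTheory GRing.Theory Num.Theory.
Import numFieldNormedType.Exports.

Local Open Scope ring_scope.

Record sgraph (V : finType) := SGraph {
  adj :> rel V;
  adj_sym : symmetric adj;
  adj_irrefl : irreflexive adj }.

Section Graphs.
Local Open Scope set_scope.
Variables (V : finType) (G : sgraph V).

Definition edges : {set {set V}} :=
  [set [set z.1; z.2] | z : V * V & G z.1 z.2].

Definition connected_graph : Prop := forall u v : V, connect G u v.

(* A path is encoded by the sequence of all its vertices, in order. *)
Definition uv_path (u v : V) (s : seq V) : bool :=
  if s is x :: p then [&& x == u, last x p == v, path G x p & uniq s]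
  else false.

Definition internal_vertices (u v : V) (s : seq V) : {set V} :=
  [set x in s] :\: [set u; v].

(* Since paths are duplicate-free, sequences of length at most #|V| suffice. *)
Definition disjoint_paths (u v : V) (P : {set #|V|.-bseq V}) : bool :=
  [forall s in P, uv_path u v s] &&
  [forall s in P, forall t in P,
     (s != t) ==> [disjoint internal_vertices u v s & internal_vertices u v t]].

Definition local_connectivity (u v : V) : nat :=
  \max_(P : {set #|V|.-bseq V} | disjoint_paths u v P) #|P|.

(* For u != v one always has local_connectivity u v <= #|V|.-1, so the default
   value of the minimum only matters when #|V| <= 1, where it yields 0. *)
Definition connectivity : nat :=
  \big[minn/#|V|.-1]_(z : V * V | z.1 != z.2) local_connectivity z.1 z.2.

Definition kconnected (k : nat) : Prop := (k <= connectivity)%N.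

End Graphs.

Section Drawings.
Local Open Scope classical_set_scope.
Variable R : realType.

Definition is_arc (a b : R * R) (A : set (R * R)) : Prop :=
  exists gamma : R -> R * R,
    [/\ {within `[0, 1], continuous gamma},
        {in `[0, 1] &, injective gamma},
        gamma 0 = a, gamma 1 = b & gamma @` `[0, 1] = A].

Variable V : finType.

(* The values of [arc] outside [edges G] are irrelevant. *)
Record drawing (G : sgraph V) := Drawing {
  vpoint : V -> R * R;
  arc : {set V} -> set (R * R);
  vpoint_inj : injective vpoint;
  arcP : forall u v, G u v -> is_arc (vpoint u) (vpoint v) (arc [set u; v]%SET);
  arc_vertex : forall e v, e \in edges G -> arc e (vpoint v) -> v \in e }.

Variables (G : sgraph V) (D : drawing G).

Definition arc_interior (e : {set V}) : set (R * R) :=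
  arc D e `\` [set vpoint D v | v in [set` e]].

(* Transversality is not required: any common interior point counts as a
   crossing point. *)
Definition cross_at (e f : {set V}) (p : R * R) : Prop :=
  [/\ e \in edges G, f \in edges G, e != f &
      (arc_interior e `&` arc_interior f) p].

Definition cross (e f : {set V}) : Prop := exists p, cross_at e f p.

(* Each edge takes part in at most one crossing; in particular no three edges
   pass through a common crossing point. *)
Definition one_plane : Prop :=
  (forall e f g p q, cross_at e f p -> cross_at e g q -> f = g /\ p = q) /\
  (forall e f, cross e f -> [disjoint e & f]%B).

(* Spanning is built in: F has the same vertex type as G. *)
Definition spanning_plane_subgraph (F : sgraph V) : Prop :=
  subrel F G /\
  (forall e f, e \in edges F -> f \in edges F -> ~ cross e f).

End Drawings.

(* Main.v *)
(** Colour the edges so that two edges get the same colour iff they are equal or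
    cross; it suffices to find a connected spanning subgraph in which no colour
    is repeated, and for this 1-planarity only matters through the fact that a
    colour has at most two edges.  By Rado's theorem for the graphic matroid,
    such a subgraph exists once every partition of [V] into [k] parts is crossed
    by at least [k - 1] colours.  Every part of a partition with [k >= 2] parts
    is left by at least 4 edges, since G is 4-connected, so at least [2 * k]
    edges and hence at least [k] colours cross the partition.

    Partitions are replaced by the subspaces of [rat^V], an edge [uv] being the
    vector [vertex_vec u - vertex_vec v], and edges are counted as ordered pairs,
    two for each edge. *)

Require Import Defs.
From mathcomp Require Import all_classical all_reals all_analysis.
From mathcomp Require Import all_boot all_order all_algebra.
From mathcomp Require Import zify.

Set Implicit Arguments.
Unset Strict Implicit.
Unset Printing Implicit Defensive.

Import Order.TTheory GRing.Theory.

(** * Rado's theorem for vectors, by deletion of elements *)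

Section Rado.
Local Open Scope set_scope.
Variables (K : fieldType) (m n : nat) (E C : finType).
Variables (A : E -> 'M[K]_(m, n)) (col : E -> C) (r : nat).

Definition colours_outside (S : {set E}) (U : 'M[K]_n) : {set C} :=
  col @: [set e in S | ~~ (A e <= U)%MS].

(** Rado's condition indexed by subspaces; taking for [U] the span of the vectors of [S] shows that
    this span has rank at least [r]. *)
Definition rado_condition (S : {set E}) : Prop :=
  forall U : 'M[K]_n, r <= #|colours_outside S U| + \rank U.

(** Deleting [e] can lose only the colour of [e], so a failure at [U] means that this colour is
    lost; hence [f], which still carries it, must lie in [U]. *)
Lemma rado_violated (S : {set E}) (U : 'M[K]_n) (e f : E) :
    f \in S -> f != e -> col f = col e -> rado_condition S ->
    #|colours_outside (S :\ e) U| + \rank U < r ->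
  [/\ (A f <= U)%MS, col e \notin colours_outside (S :\ e) U &
      colours_outside S U = col e |: colours_outside (S :\ e) U].
Proof.
move=> fS nfe cfe rS lt_r.
have sub1 : colours_outside (S :\ e) U \subset colours_outside S U.
  by apply: imsetS; apply/subsetP=> x; rewrite !inE => /andP [/andP [_ ->] ->].
have sub2 : colours_outside S U \subset col e |: colours_outside (S :\ e) U.
  apply/subsetP=> c /imsetP [x]; rewrite inE => /andP [xS xU] ->.
  have [-> | nxe] := eqVneq x e; first by rewrite setU11.
  by apply/setU1P; right; apply/imset_f; rewrite !inE nxe xS.
have nsub : ~~ (colours_outside S U \subset colours_outside (S :\ e) U).
  apply: contraL lt_r => /subset_leq_card le_c.
  by rewrite -leqNgt (leq_trans (rS U)) // leq_add2r.
have notin : col e \notin colours_outside (S :\ e) U.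
  apply: contra nsub => ce; apply: subset_trans sub2 _.
  by rewrite subUset sub1set ce subxx.
split=> //.
  apply: contraR notin => fU; rewrite -cfe; apply: imset_f.
  by rewrite !inE nfe fS.
apply/eqP; rewrite eqEsubset sub2 subUset sub1set sub1 andbT /=.
apply: contraR nsub => ce; apply/subsetP=> c cS.
have := subsetP sub2 c cS; rewrite in_setU1 => /orP [/eqP cE | //].
by rewrite -cE cS in ce.
Qed.

(* If the condition fails for [S :\ e] at [P] and for [S :\ f] at [Q], then the
   colour of [e] and [f] is counted at [P] and at [Q] but not at [P + Q], so the
   condition fails for [S] at [P + Q] or at [P :&: Q]. *)
Lemma rado_delete (S : {set E}) (e f : E) :
    e \in S -> f \in S -> e != f -> col e = col f -> rado_condition S ->
  rado_condition (S :\ e) \/ rado_condition (S :\ f).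
Proof.
move=> eS fS nef cef rS.
apply: contrapT => /not_orP [].
rewrite /rado_condition => /existsNP [P nP] /existsNP [Q nQ].
move/negP: nP; rewrite -ltnNge => nP; move/negP: nQ; rewrite -ltnNge => nQ.
have nfe : f != e by rewrite eq_sym.
have [fP eNP defP] := rado_violated fS nfe (esym cef) rS nP.
have [eQ fNQ defQ] := rado_violated eS nef cef rS nQ.
rewrite -cef in fNQ defQ.
set CP := colours_outside S P in defP; set CQ := colours_outside S Q in defQ.
have ePQ : col e \in CP :&: CQ by rewrite inE defP defQ !setU11.
have sub_cap : colours_outside S (P :&: Q)%MS \subset CP :|: CQ.
  apply/subsetP=> c /imsetP [x]; rewrite inE sub_capmx negb_and.
  case/andP=> xS /orP [] xU ->; apply/setUP; [left | right].
    by apply: imset_f; rewrite inE xS.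
  by apply: imset_f; rewrite inE xS.
have sub_sum : colours_outside S (P + Q)%MS \subset (CP :&: CQ) :\ col e.
  apply/subsetP=> c /imsetP [x]; rewrite inE => /andP [xS xPQ] ->.
  have xP : ~~ (A x <= P)%MS.
    by apply: contra xPQ => xP; apply: submx_trans xP (addsmxSl _ _).
  have xQ : ~~ (A x <= Q)%MS.
    by apply: contra xPQ => xQ; apply: submx_trans xQ (addsmxSr _ _).
  have nxe : x != e by apply: contraNneq xQ => ->.
  have outside U : ~~ (A x <= U)%MS -> col x \in colours_outside S U.
    by move=> xU; apply: imset_f; rewrite inE xS.
  rewrite !inE !outside // !andbT.
  (* An element other than [e] of colour [col e] outside [P] would contradict [eNP]. *)
  apply: contraNneq eNP => <-; apply: imset_f.
  by rewrite !inE nxe xS.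
(* The failures say [#|CP| + \rank P <= r] and [#|CQ| + \rank Q <= r]. By modularity, the conditions
   at [P + Q] and [P :&: Q] make the sum of the left sides exceed [2 * r], by the 1 that [col e]
   contributes. *)
have := subset_leq_card sub_cap; have := subset_leq_card sub_sum.
have := cardsUI CP CQ; have := mxrank_sum_cap P Q.
have cP : #|CP| = #|colours_outside (S :\ e) P|.+1 by rewrite defP cardsU1 eNP.
have cQ : #|CQ| = #|colours_outside (S :\ f) Q|.+1 by rewrite defQ cardsU1 fNQ.
rewrite (cardsD1 (col e) (CP :&: CQ)) ePQ.
have := rS (P + Q)%MS; have := rS (P :&: Q)%MS.
move: nP nQ cP cQ.
lia.
Qed.

(** While a colour is repeated, [rado_delete] removes one of two elements that share it; each
    removal shrinks [S]. *)
Lemma rado_transversal (S : {set E}) : rado_condition S ->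
  exists T : {set E},
    [/\ T \subset S, {in T &, injective col} & rado_condition T].
Proof.
have [k] := ubnP #|S|; elim: k S => // k IHk S leS rS.
have [injS | ninjS] := pselect {in S &, injective col}.
  by exists S; split.
have [e [f [eS fS nef cef]]] :
    exists e f, [/\ e \in S, f \in S, e != f & col e = col f].
  apply: contrapT => nex; apply: ninjS => e f eS fS cef.
  by apply/eqP; apply: contrapT => /negP nef; apply: nex; exists e, f.
have step x : x \in S -> rado_condition (S :\ x) -> exists T : {set E},
    [/\ T \subset S, {in T &, injective col} & rado_condition T].
  move=> xS rSx; have ltS : #|S :\ x| < k.
    by rewrite (cardsD1 x S) xS in leS.
  have [T [TS injT rT]] := IHk _ ltS rSx.
  by exists T; split=> //; apply: subset_trans TS (subsetDl _ _).
by case: (rado_delete eS fS nef cef rS); apply: step.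
Qed.

End Rado.

(** * Edge cuts and connectivity *)

Section EdgeCuts.
Local Open Scope set_scope.
Variables (V : finType) (G : sgraph V).

Lemma path_leaves (X : {set V}) (x : V) (p : seq V) :
    path G x p -> x \in X -> last x p \notin X ->
  exists p1 p2 a b,
    [/\ x :: p = p1 ++ a :: b :: p2, G a b, a \in X & b \notin X].
Proof.
elim: p x => [|y p IHp] x /=; first by move=> _ ->.
case/andP=> Gxy Gp xX lX; have [yX | yX] := boolP (y \in X); last first.
  by exists [::], p, x, y.
have [p1 [p2 [a [b [-> Gab aX bX]]]]] := IHp y Gp yX lX.
by exists (x :: p1), p2, a, b.
Qed.

(** This settles the one case in which internally disjoint paths could share an arc. *)
Lemma uv_path_edge (u v : V) (p1 p2 : seq V) :
  uv_path G u v (p1 ++ u :: v :: p2) -> p1 = [::] /\ p2 = [::].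
Proof.
case: p1 => [|x p1] /=.
  move=> /and4P [_ lp _ /and3P [_ vp2 _]]; split=> //.
  case: p2 => // y p2 in lp vp2 *.
  by move: vp2; rewrite -(eqP lp) /= mem_last.
case/and4P=> /eqP -> _ _ /andP [].
by rewrite mem_cat inE eqxx orbT.
Qed.

(** The easy half of Menger's theorem: each path leaves [X] along some arc, and internally disjoint
    paths do so along different arcs. *)
Lemma edge_cut_ge_local_connectivity (X : {set V}) (u v : V) :
    u \in X -> v \notin X ->
  local_connectivity G u v <=
    #|[set z : V * V | [&& G z.1 z.2, z.1 \in X & z.2 \notin X]]|.
Proof.
move=> uX vX; apply/bigmax_leqP=> P /andP [/forall_inP pathP /forall_inP disP].
(* Stated for all sequences, with the dummy [(u, u)] outside [P], so that [choice] gives a total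
   [h]. *)
have leaves (s : #|V|.-bseq V) : exists z : V * V, s \in P ->
    exists p1 p2, [/\ bseqval s = p1 ++ z.1 :: z.2 :: p2,
                     G z.1 z.2, z.1 \in X & z.2 \notin X].
  have [sP | _] := boolP (s \in P); last by exists (u, u).
  have := pathP s sP; case: (bseqval s) => //= x p.
  case/and4P=> /eqP -> /eqP lp Gp _.
  have lX : last u p \notin X by rewrite lp.
  have [p1 [p2 [a [b [-> Gab aX bX]]]]] := path_leaves Gp uX lX.
  by exists (a, b) => _; exists p1, p2.
have [h hP] := choice leaves.
have inj_h : {in P &, injective h}.
  move=> s t sP tP hst; apply/eqP; apply: contrapT => /negP nst.
  have [p1 [p2 [defs _ aX bX]]] := hP s sP.
  have [q1 [q2 [deft _ _ _]]] := hP t tP; rewrite -hst in deft.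
  have /forall_inP /(_ t tP) := disP s sP; rewrite nst /= => dis.
  (* A shared tail other than [u] would be internal to both paths, since it lies in [X] and so
     differs from [v]; likewise for the head. Hence both paths are the single edge [uv]. *)
  have au : (h s).1 = u.
    apply: contraTeq dis => nau; apply/pred0Pn; exists (h s).1 => /=.
    rewrite !inE (negPf nau) /= defs deft !mem_cat !inE eqxx !orbT /=.
    rewrite !andbT andbb.
    by apply: contraNneq vX => <-.
  have bv : (h s).2 = v.
    apply: contraTeq dis => nbv; apply/pred0Pn; exists (h s).2 => /=.
    rewrite !inE (negPf nbv) /= defs deft !mem_cat !inE eqxx !orbT /=.
    rewrite !orbF !andbT andbb.
    by apply: contraNneq bX => ->.
  move: (pathP s sP) (pathP t tP) nst; rewrite defs deft au bv.
  move=> /uv_path_edge [e1 e2] /uv_path_edge [e3 e4] /eqP; apply.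
  by apply: val_inj; rewrite /= defs deft e1 e2 e3 e4.
rewrite -(card_in_imset inj_h); apply/subset_leq_card/subsetP=> z.
case/imsetP=> s sP ->; have [p1 [p2 [_ Gz aX bX]]] := hP s sP.
by rewrite inE Gz aX.
Qed.

Lemma connectivity_le (u v : V) :
  u != v -> connectivity G <= local_connectivity G u v.
Proof.
move=> nuv; rewrite -leEnat /connectivity -minEnat.
exact: (@bigmin_le_cond _ _ _ _ (u, v)).
Qed.

(** The parts are the fibres of [rep]. Each has at least [k] outgoing arcs, and an arc is counted
    only at the part of its tail. *)
Lemma partition_cut (T : finType) (k : nat) (rep : V -> T) :
    kconnected G k -> 1 < #|[set rep v | v : V]| ->
  k * #|[set rep v | v : V]| <=
    #|[set z : V * V | G z.1 z.2 & rep z.1 != rep z.2]|.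
Proof.
move=> kG rep_gt1.
rewrite -[leqRHS]sum1_card.
rewrite (partition_big (fun z => rep z.1) (mem [set rep v | v : V])) /=;
  last by move=> z _; apply: imset_f.
rewrite mulnC -sum_nat_const; apply: leq_sum => r /imsetP [u _ ru].
have [s] : exists s, s \in [set rep v | v : V] :\ r.
  apply/set0Pn; rewrite -card_gt0.
  by move: rep_gt1; rewrite (cardsD1 r) ru imset_f.
rewrite !inE => /andP [nsr /imsetP [v _ sv]].
pose X := [set w | rep w == r].
have uX : u \in X by rewrite inE ru.
have vX : v \notin X by rewrite inE -sv.
have nuv : u != v by apply: contraNneq vX => <-.
apply: leq_trans kG _; apply: leq_trans (connectivity_le nuv) _.
apply: leq_trans (edge_cut_ge_local_connectivity uX vX) _.
rewrite sum1dep_card; apply/subset_leq_card/subsetP=> z.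
by rewrite !inE => /and3P [-> /eqP -> nz] /=; rewrite eq_sym nz eqxx.
Qed.

End EdgeCuts.

(** * The graphic matroid, represented over the rationals *)

Section GraphicMatroid.
Local Open Scope set_scope.
Variables (V : finType) (G : sgraph V).

Definition vertex_vec (v : V) : 'rV[rat]_#|V| := delta_mx 0%R (enum_rank v).

Definition edge_vec (z : V * V) : 'rV[rat]_#|V| :=
  (vertex_vec z.1 - vertex_vec z.2)%R.

(** Vertices are identified when their difference lies in [U]. One vector per class spans, together
    with [U], the whole space, which gives the rank bound. *)
Lemma subspace_labelling (U : 'M[rat]_#|V|) : exists rep : V -> V,
  (forall z, (edge_vec z <= U)%MS = (rep z.1 == rep z.2)) /\
  #|V| <= #|[set rep v | v : V]| + \rank U.
Proof.
pose R u v := (edge_vec (u, v) <= U)%MS.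
have Rxx u : R u u by rewrite /R /edge_vec subrr sub0mx.
have Rsym u v : R u v -> R v u.
  by rewrite /R /edge_vec /= -opprB eqmx_opp.
have Rtr u v w : R u v -> R v w -> R u w.
  rewrite /R /edge_vec /= => uv vw.
  by rewrite -(subrKA (vertex_vec v)) addmx_sub.
pose rep u := odflt u [pick w | R u w].
have R_rep u : R u (rep u).
  by rewrite /rep; case: pickP => //= /(_ u); rewrite Rxx.
(* [pick] sees only the class of [u]; by reflexivity the default is never reached. *)
have rep_eq u v : R u v -> rep u = rep v.
  move=> uv; rewrite /rep.
  have -> : [pick w | R u w] = [pick w | R v w].
    by apply: eq_pick => w; apply/idP/idP; apply: Rtr => //; apply: Rsym.
  by case: pickP => //= /(_ v); rewrite Rxx.
exists rep; split=> [[u v] /= | ].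
  apply/idP/eqP => [/rep_eq // | ruv].
  by apply: (Rtr _ _ _ (R_rep u)); rewrite ruv; apply: Rsym.
pose W := (\sum_(r in [set rep v | v : V]) <<vertex_vec r>>)%MS.
have rankW : \rank W <= #|[set rep v | v : V]|.
  rewrite -sum1_card.
  apply: (big_ind2 (fun B k => \rank B <= k)) => [|B k B' k' Bk Bk'|r _].
  - by rewrite mxrank0.
  - by apply: leq_trans (mxrank_adds_leqif _ _).1 (leq_add Bk Bk').
  - by rewrite mxrank_gen rank_leq_row.
have full : ((1%:M)%R <= W + U)%MS.
  apply/row_subP => i; rewrite rowE mulmx1 -[i]enum_valK.
  rewrite -[delta_mx _ _]/(vertex_vec (enum_val i)).
  rewrite -[vertex_vec _](addrNK (vertex_vec (rep (enum_val i)))) addrC.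
  rewrite addmx_sub_adds //; last exact: R_rep.
  by rewrite (sumsmx_sup (rep (enum_val i))) ?imset_f ?genmxE.
have := mxrankS full; rewrite mxrank1 => /leq_trans; apply.
by apply: leq_trans (mxrank_adds_leqif _ _).1 _; rewrite leq_add2r.
Qed.

(** If [U] has [p >= 2] classes, at least [k * p] arcs lie outside [U] and a colour covers at most
    [k] of them, so at least [p] colours occur. If [p <= 1], [\rank U] alone reaches the bound. *)
Lemma kconnected_rado (C : finType) (col : V * V -> C) (k : nat) :
    0 < k -> kconnected G k ->
    (forall c, #|[set z : V * V | G z.1 z.2 & col z == c]| <= k) ->
  rado_condition edge_vec col #|V|.-1 [set z | G z.1 z.2].
Proof.
move=> k_gt0 kG fib U.
have [rep [repP leV]] := subspace_labelling U.
have [gt1 | le1] := ltnP 1 #|[set rep v | v : V]|; last first.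
  rewrite -subn1 leq_subLR; apply: leq_trans leV _.
  by rewrite addnA leq_add2r (leq_trans le1) ?leq_addr.
apply: leq_trans (leq_pred _) _; apply: leq_trans leV _; rewrite leq_add2r.
rewrite -(leq_pmul2l k_gt0); apply: leq_trans (partition_cut kG gt1) _.
rewrite mulnC -sum_nat_const -[leqLHS]sum1_card.
rewrite (partition_big col (mem (colours_outside edge_vec col
  [set z | G z.1 z.2] U))) /=; last first.
  by move=> z; rewrite inE => /andP [Gz rz]; rewrite imset_f // !inE Gz repP.
apply: leq_sum => c _; rewrite sum1dep_card; apply: leq_trans (fib c).
by apply/subset_leq_card/subsetP=> z; rewrite !inE => /andP [/andP [-> _] ->].
Qed.

(** If [v] were unreachable from [u], the vertices reachable from [u] and the remaining ones would
    give two independent linear forms vanishing on [T]; their common kernel leaves no colour outside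
    and has corank 2. *)
Lemma rado_connected (C : finType) (col : V * V -> C) (T : {set V * V})
    (F : rel V) :
    (forall z, z \in T -> F z.1 z.2 /\ F z.2 z.1) ->
    rado_condition edge_vec col #|V|.-1 T ->
  forall u v, connect F u v.
Proof.
move=> TF rT u v; apply: contraT => nuv.
pose X := [set w | connect F u w].
(* Column 0 is the indicator of [X], column 1 that of its complement. *)
pose M : 'M[rat]_(#|V|, 2) :=
  (\matrix_(i, j) ((enum_val i \in X) == (j == 0))%:R)%R.
have mulM w j : ((vertex_vec w *m M) 0 j = ((w \in X) == (j == 0))%:R)%R.
  by rewrite -rowE !mxE enum_rankK.
have rankM : 1 < \rank M.
  suff eq1 : (col_mx (vertex_vec u) (vertex_vec v) *m M = 1%:M)%R.
    by have := mxrankM_maxr (col_mx (vertex_vec u) (vertex_vec v)) M;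
       rewrite eq1 mxrank1.
  apply/matrixP => i j; rewrite mul_col_mx -[i]splitK /unsplit.
  case: split => k; rewrite (ord1 k) ?col_mxEu ?col_mxEd mulM !inE.
    by rewrite connect0 mxE; case: j => -[|[|[]]].
  by rewrite (negPf nuv) mxE; case: j => -[|[|[]]].
have edge0 z : z \in T -> (edge_vec z <= kermx M)%MS.
  move=> /TF [F12 F21]; rewrite sub_kermx mulmxBl subr_eq0.
  apply/eqP/rowP => j; rewrite !mulM !inE; congr (_ == _)%:R%R.
  by apply/idP/idP => /connect_trans; apply; apply: connect1.
have := rT (kermx M); rewrite mxrank_ker.
have -> : colours_outside edge_vec col T (kermx M) = set0.
  apply/setP=> c; rewrite inE; apply/imsetP => -[z].
  by rewrite inE => /andP [/edge0 ->].
(* With [\rank M > 1] this bound forces [#|V| >= 2], excluding the truncated case [#|V|.-1 = 0]. *)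
have := rank_leq_row M; rewrite cards0; lia.
Qed.

End GraphicMatroid.

(** * Crossing pairs as colour classes *)

Section Crossings.
Local Open Scope set_scope.
Variables (R : realType) (V : finType) (G : sgraph V) (D : drawing R G).
Hypothesis plane1 : one_plane D.

Lemma cross_sym (e f : {set V}) : cross D e f -> cross D f e.
Proof. by move=> [p [eG fG nef [pe pf]]]; exists p; split; rewrite 1?eq_sym. Qed.

Lemma cross_unique (e f g : {set V}) : cross D e f -> cross D e g -> f = g.
Proof. by move=> [p ef] [q eg]; case: (plane1.1 _ _ _ _ _ ef eg). Qed.

Definition crossing_class (e : {set V}) : {set {set V}} :=
  e |: [set f | `[< cross D e f >]].

(** A crossed edge has a single partner, so both classes are the pair [[set e; f]]. *)
Lemma cross_crossing_class (e f : {set V}) :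
  cross D e f -> crossing_class e = crossing_class f.
Proof.
move=> ef; have fe := cross_sym ef.
have class g h : cross D g h -> crossing_class g = [set g; h].
  move=> gh; apply/setP=> x; rewrite !inE; congr (_ || _).
  by apply/asboolP/eqP => [/(cross_unique gh) | ->].
by rewrite (class e f) // (class f e) // setUC.
Qed.

Lemma card_crossing_class (e : {set V}) : #|crossing_class e| <= 2.
Proof.
rewrite cardsU1 -[leqRHS]/(1 + 1) leq_add ?leq_b1 //.
apply/card_le1_eqP => f g; rewrite !inE => /asboolP ef /asboolP eg.
exact: cross_unique eg ef.
Qed.

(** Two edges per class and two orientations per edge; this 4 is what 4-connectivity has to
    match. *)
Lemma card_crossing_arcs (c : {set {set V}}) :
  #|[set z : V * V | G z.1 z.2 & crossing_class [set z.1; z.2] == c]| <= 4.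
Proof.
have arcs2 (e : {set V}) : e \in edges G ->
    #|[set z : V * V | [set z.1; z.2] == e]| <= 2.
  case/imsetP=> -[a b] _ -> /=.
  apply: (@leq_trans #|[set (a, b); (b, a)]|); last by rewrite cards2; case: eqP.
  apply: subset_leq_card.
  apply/subsetP=> -[x y]; rewrite !inE /= !xpair_eqE => /eqP xy.
  have := set21 x y; have := set22 x y; have := set21 a b; have := set22 a b.
  rewrite -{1 2}xy {3 4}xy => {xy}; rewrite !inE.
  by do 4![case/orP=> /eqP ?]; subst; rewrite !eqxx ?orbT.
set S := [set z | _ & _].
have [-> | [z0]] := set_0Vmem S; first by rewrite cards0.
rewrite inE => /andP [_ /eqP c0].
have c2 : #|c :&: edges G| <= 2.
  rewrite -c0; apply: leq_trans (card_crossing_class _).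
  exact/subset_leq_card/subsetIl.
rewrite -sum1_card.
rewrite (partition_big (fun z => [set z.1; z.2]) (mem (c :&: edges G))) /=.
  apply: (@leq_trans (\sum_(e in c :&: edges G) 2)).
  - apply: leq_sum => e; rewrite inE => /andP [_ /arcs2]; apply: leq_trans.
    rewrite sum1dep_card; apply/subset_leq_card/subsetP=> z.
    by rewrite !inE => /andP [].
  - by rewrite sum_nat_const -[leqRHS]/(2 * 2) leq_mul2r.
move=> z; rewrite !inE => /andP [Gz /eqP <-].
by rewrite setU11 /=; apply/imsetP; exists z; rewrite ?inE.
Qed.

End Crossings.

Theorem theorem1 (R : realType) (V : finType) (G : sgraph V)
    (D : drawing R G) :
  kconnected G 4 -> one_plane D ->
  exists F : sgraph V, spanning_plane_subgraph D F /\ connected_graph F.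
Proof.
move=> kG plane1.
pose col (z : V * V) := crossing_class D [set z.1; z.2]%SET.
have [T [TG injT rT]] := rado_transversal
  (kconnected_rado (isT : 0 < 4) kG (card_crossing_arcs plane1) :
     rado_condition _ col _ _).
(* Both orientations of an edge have the same colour, so [T] contains at most one of them and must
   be symmetrised. *)
pose adjF : rel V := fun u v => ((u, v) \in T) || ((v, u) \in T).
have adjF_sym : symmetric adjF by move=> u v; rewrite /adjF orbC.
have TadjG z : z \in T -> G z.1 z.2 by move/(subsetP TG); rewrite inE.
have adjF_irr : irreflexive adjF.
  move=> u; apply/negbTE; rewrite /adjF orbb; apply/negP => /TadjG /=.
  by rewrite adj_irrefl.
exists (SGraph adjF_sym adjF_irr); split; last first.
  by apply: rado_connected rT => -[u v] uvT /=; rewrite /adjF uvT orbT.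
split=> [u v | e f].
  by case/orP=> /TadjG //=; rewrite adj_sym.
have edgeF g : g \in edges (SGraph adjF_sym adjF_irr) ->
    exists2 z, z \in T & g = [set z.1; z.2]%SET.
  case/imsetP=> -[a b]; rewrite inE /= => /orP [] abT ->.
    by exists (a, b).
  by exists (b, a); rewrite //= setUC.
move=> /edgeF [y yT ->] /edgeF [z zT ->] yz.
(* Crossing edges share their colour, so injectivity merges them, whereas no edge crosses itself. *)
have eq_yz : y = z by apply: injT => //; apply: cross_crossing_class.
by case: yz => p [_ _]; rewrite eq_yz eqxx.
Qed.
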